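(* Let $A=\mathrm{diag}\{\lambda_1,\dots,\lambda_n\}$ with $0<\lambda_1<\lambda_2<\cdots<\lambda_n$, let $b\in\mathbb{R}^n$, and let $f(x)=\frac12 x^{\top}Ax-b^{\top}x$. Let $x_0\in\mathbb{R}^n$ and let $\{x_k\}$ be generated by the gradient method $x_{k+1}=x_k-\alpha_k g_k$, where $g_k=\nabla f(x_k)=Ax_k-b$ and $\alpha_k>0$. Suppose that the stepsizes $\alpha_k$ satisfy Property B (defined in the context) with integer $m$, constant $M_1\geqslant\lambda_1$ and function $\psi$. Then either $g_k=0$ for some finite $k$, or the sequence $\{\|g_k\|\}$ converges to zero $R$-linearly in the sense that, for all $k\geqslant 0$, $$|g_k^{(i)}|\leqslant C_i\,\theta^k,\qquad i=1,2,\dots,n,$$ where $\theta=1-\lambda_1/M_1$, $C_1=|g_0^{(1)}|$, and for $i=2,3,\dots,n$, $$C_i=\max\left\{|g_0^{(i)}|,\ \frac{|g_1^{(i)}|}{\theta},\ \dots,\ \frac{|g_{m-1}^{(i)}|}{\theta^{m-1}},\ \frac{\max\{\sigma_i,\sigma_i^m\}}{\theta^m\,\psi(\lambda_i)}\sqrt{\sum_{j=1}^{i-1}\psi^2(\lambda_j)\,C_j^2}\right\},$$ with $\sigma_i=\max\left\{\frac{\lambda_i}{\lambda_1}-1,\ 1-\frac{\lambda_i}{M_1}\right\}$.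
   Context: $g_k^{(i)}$ denotes the $i$-th component of $g_k\in\mathbb{R}^n$, and $\psi^2(A)=\psi(A)^2$, where $\psi(A)=\mathrm{diag}\{\psi(\lambda_1),\dots,\psi(\lambda_n)\}$. Property B: the stepsizes $\alpha_k$ have Property B if there exist a positive integer $m$ and a positive constant $M_1\geqslant\lambda_1$ such that, for every $k\geqslant 0$ (the iteration being stopped if $g_k=0$): (i) $\lambda_1\leqslant\alpha_k^{-1}\leqslant M_1$; (ii) for some integer $v(k)\in\{k,k-1,\dots,\max\{k-m+1,0\}\}$, $$\alpha_k\leqslant\frac{g_{v(k)}^{\top}\psi^2(A)g_{v(k)}}{g_{v(k)}^{\top}A\psi^2(A)g_{v(k)}},$$ where $\psi$ (not depending on $k$) is a real analytic function on $[\lambda_1,\lambda_n]$ that can be expressed by a Laurent series $\psi(z)=\sum_{p=-\infty}^{\infty}d_p z^p$, $d_p\in\mathbb{R}$, with $0<\sum_{p=-\infty}^{\infty}d_p z^p<+\infty$ for all $z\in[\lambda_1,\lambda_n]$. *)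

(* Defs.v *)
From HB Require Import structures.
From mathcomp Require Import all_boot all_order all_algebra.
From mathcomp Require Import all_classical all_reals all_analysis.
From mathcomp Require Import ring.
Set Implicit Arguments.
Unset Strict Implicit.
Unset Printing Implicit Defensive.
Import Order.TTheory GRing.Theory Num.Theory.
Import numFieldNormedType.Exports.
Local Open Scope classical_set_scope.
Local Open Scope ring_scope.

(* MathComp with MathComp-Analysis. The dimension is n.+1 and indices start
   at 0: lambda ord0 is lambda_1, lambda ord_max is the largest eigenvalue. *)

(* Euclidean norm; the library norm on matrices is the sup norm. *)
Definition enorm (R : realType) (n : nat) (u : 'cV[R]_n) : R :=
  Num.sqrt (\sum_i u i 0 ^+ 2).

Definition gradient (R : realType) (n : nat) (f : 'cV[R]_n.+1 -> R)
    (x : 'cV[R]_n.+1) : 'cV[R]_n.+1 :=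
  \col_i 'D_(delta_mx i 0) f x.

Definition diagA (R : realType) (n : nat) (lambda : 'I_n.+1 -> R)
    : 'M[R]_n.+1 :=
  diag_mx (\row_i lambda i).

Definition psiA (R : realType) (n : nat) (psi : R -> R)
    (lambda : 'I_n.+1 -> R) : 'M[R]_n.+1 :=
  diag_mx (\row_i psi (lambda i)).

Definition quad (R : realType) (n : nat) (lambda : 'I_n.+1 -> R)
    (b x : 'cV[R]_n.+1) : R :=
  2^-1 * (x^T *m diagA lambda *m x) 0 0 - (b^T *m x) 0 0.

Lemma quadE (R : realType) (n : nat) (lambda : 'I_n.+1 -> R)
    (b x : 'cV[R]_n.+1) :
  quad lambda b x =
    \sum_i (2^-1 * (lambda i * x i 0 ^+ 2) - b i 0 * x i 0).
Proof.
rewrite /quad -mulmxA mul_diag_mx !mxE big_distrr -sumrB.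
by apply: eq_bigr => i _; rewrite !mxE mulrCA -expr2.
Qed.

Lemma gradient_quad (R : realType) (n : nat) (lambda : 'I_n.+1 -> R)
    (b x : 'cV[R]_n.+1) :
  gradient (quad lambda b) x = diagA lambda *m x - b.
Proof.
apply/matrixP => i j; rewrite !ord1 mul_diag_mx !mxE.
apply: cvg_lim => //.
have E (h : R) : h != 0 ->
    lambda i * x i 0 - b i 0 + h * (2^-1 * lambda i) =
    h^-1 *: (quad lambda b (h *: delta_mx i 0 + x) - quad lambda b x).
  move=> h0; rewrite !quadE -sumrB (bigD1 i) //=.
  rewrite [X in _ *: (_ + X)]big1; last first.
    move=> k ki; rewrite !mxE eqxx andbT (negbTE ki) mulr0 add0r; exact: subrr.
  rewrite addr0 !mxE !eqxx mulr1 /GRing.scale /=; field.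
  exact: h0.
apply: (@cvg_trans _
  ((fun h : R => lambda i * x i 0 - b i 0 + h * (2^-1 * lambda i)) @ 0^')).
  apply: near_eq_cvg; near=> h; apply: E.
  by near: h; exact: nbhs_dnbhs_neq.
apply: cvg_within_filter.
have H : (fun h : R => lambda i * x i 0 - b i 0 + h * (2^-1 * lambda i)) @ 0
    --> lambda i * x i 0 - b i 0 + 0 * (2^-1 * lambda i).
  apply: cvgD; first exact: cvg_cst.
  by apply: cvgM; [exact: cvg_id | exact: cvg_cst].
by rewrite mul0r addr0 in H.
Unshelve. all: by end_near.
Qed.

(* Near every point of [a, b], psi coincides on [a, b] with the sum of a power
   series centred at that point; the values of psi outside [a, b] are
   irrelevant. *)
Definition analytic_on (R : realType) (a b : R) (psi : R -> R) : Prop :=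
  forall z0, a <= z0 <= b ->
  exists c : nat -> R, exists2 r : R, 0 < r &
    forall z, a <= z <= b -> `|z - z0| < r ->
      pseries c (z - z0) @ \oo --> psi z.

(* The two-sided series converges to s: both its part with exponents p >= 0 and
   its part with exponents p < 0 converge, and s is the sum of the two limits. *)
Definition laurent_cvg (R : realType) (d : int -> R) (z s : R) : Prop :=
  exists sp sn : R,
    [/\ series (fun p : nat => d p%:Z * z ^ p%:Z) @ \oo --> sp,
        series (fun p : nat => d (- p.+1%:Z) * z ^ (- p.+1%:Z)) @ \oo --> sn
      & s = sp + sn].

Definition admissible (R : realType) (a b : R) (psi : R -> R) : Prop :=
  analytic_on a b psi /\
  exists d : int -> R, forall z, a <= z <= b ->
    laurent_cvg d z (psi z) /\ 0 < psi z.

(* Since k.+1 - m is truncated, it is max(k - m + 1, 0). The guard g k != 0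
   accounts for stopping; along a gradient iteration g k != 0 forces g v != 0
   for v <= k, so the denominator below does not vanish. *)
Definition propertyB (R : realType) (n : nat) (lambda : 'I_n.+1 -> R)
    (m : nat) (M1 : R) (psi : R -> R)
    (alpha : nat -> R) (g : nat -> 'cV[R]_n.+1) : Prop :=
  [/\ (0 < m)%N, 0 < M1, lambda ord0 <= M1,
      admissible (lambda ord0) (lambda ord_max) psi
    & forall k, g k != 0 ->
        lambda ord0 <= (alpha k)^-1 <= M1 /\
        exists2 v : nat, (k.+1 - m <= v <= k)%N &
          alpha k <=
            ((g v)^T *m psiA psi lambda ^+ 2 *m g v) 0 0 /
            ((g v)^T *m diagA lambda *m psiA psi lambda ^+ 2 *m g v) 0 0].

Definition theta (R : realType) (n : nat) (lambda : 'I_n.+1 -> R) (M1 : R) : R :=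
  1 - lambda ord0 / M1.

Definition sigma (R : realType) (n : nat) (lambda : 'I_n.+1 -> R) (M1 : R)
    (i : 'I_n.+1) : R :=
  Num.max (lambda i / lambda ord0 - 1) (1 - lambda i / M1).

(* Fuelled version of the strong recursion on i defining C_i; the fuel k
   suffices as soon as i <= k, and CconstE is the recursion itself. *)
Fixpoint Crec (R : realType) (n : nat) (lambda : 'I_n.+1 -> R) (m : nat)
    (M1 : R) (psi : R -> R) (g : nat -> 'cV[R]_n.+1) (k : nat) (i : 'I_n.+1)
    : R :=
  if k is k'.+1 then
    if i == ord0 then `|g 0%N i 0| else
    Num.max
      (\big[Num.max/`|g 0%N i 0|]_(1 <= l < m)
         (`|g l i 0| / theta lambda M1 ^+ l))
      (Num.max (sigma lambda M1 i) (sigma lambda M1 i ^+ m) /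
         (theta lambda M1 ^+ m * psi (lambda i)) *
       Num.sqrt (\sum_(j < n.+1 | (j < i)%N)
         psi (lambda j) ^+ 2 * Crec lambda m M1 psi g k' j ^+ 2))
  else `|g 0%N i 0|.

Definition Cconst (R : realType) (n : nat) (lambda : 'I_n.+1 -> R) (m : nat)
    (M1 : R) (psi : R -> R) (g : nat -> 'cV[R]_n.+1) (i : 'I_n.+1) : R :=
  Crec lambda m M1 psi g i i.

Lemma Crec_fuel (R : realType) (n : nat) (lambda : 'I_n.+1 -> R) (m : nat)
    (M1 : R) (psi : R -> R) (g : nat -> 'cV[R]_n.+1) (k : nat) (i : 'I_n.+1) :
  (i <= k)%N -> Crec lambda m M1 psi g k i = Cconst lambda m M1 psi g i.
Proof.
rewrite /Cconst; move e: (nat_of_ord i) => i'.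
elim/ltn_ind: i' k i e => -[|i'] IH [|k] i e //= ik.
  by rewrite ifT //; apply/eqP/val_inj.
case: ifP => // _; congr (Num.max _ (_ * Num.sqrt _)).
apply: eq_bigr => j; rewrite e ltnS => ji.
have h t : (j <= t)%N -> Crec lambda m M1 psi g t j = Crec lambda m M1 psi g j j.
  by move=> jt; exact: (IH j).
by rewrite !h // (leq_trans ji).
Qed.

Lemma CconstE (R : realType) (n : nat) (lambda : 'I_n.+1 -> R) (m : nat)
    (M1 : R) (psi : R -> R) (g : nat -> 'cV[R]_n.+1) (i : 'I_n.+1) :
  Cconst lambda m M1 psi g i =
  if i == ord0 then `|g 0%N i 0| else
  Num.max
    (\big[Num.max/`|g 0%N i 0|]_(1 <= l < m)
       (`|g l i 0| / theta lambda M1 ^+ l))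
    (Num.max (sigma lambda M1 i) (sigma lambda M1 i ^+ m) /
       (theta lambda M1 ^+ m * psi (lambda i)) *
     Num.sqrt (\sum_(j < n.+1 | (j < i)%N)
       psi (lambda j) ^+ 2 * Cconst lambda m M1 psi g j ^+ 2)).
Proof.
rewrite -(@Crec_fuel _ _ _ _ _ _ _ i.+1) //=; case: ifP => // _.
congr (Num.max _ (_ * Num.sqrt _)); apply: eq_bigr => j ji.
by rewrite Crec_fuel // ltnW.
Qed.

(* Main.v *)
(* In the eigenbasis the components decouple: each step multiplies component i
   by 1 - alpha_k lambda_i, of absolute value at most sigma_i.  If
   alpha_k (lambda_1 + lambda_i) <= 2, this factor is even at most theta in
   absolute value.  Otherwise condition (ii) of Property B says that a weighted
   sum with weights decreasing in the index is nonnegative, which forces the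
   i-th psi-weighted component of g_v(k) to be dominated by the previous ones;
   these decay like theta^v by induction on i, and at most m steps, each losing
   at most a factor sigma_i, separate v(k) from k + 1.
   If theta = 0 then alpha_k = 1 / lambda_1, and (ii) forces g_1 = 0. *)
Require Import Defs.
From HB Require Import structures.
From mathcomp Require Import all_boot all_order all_algebra.
From mathcomp Require Import all_classical all_reals all_analysis.
From mathcomp Require Import ring lra.
Set Implicit Arguments.
Unset Strict Implicit.
Unset Printing Implicit Defensive.
Import Order.TTheory GRing.Theory Num.Theory.
Import numFieldNormedType.Exports.
Local Open Scope classical_set_scope.
Local Open Scope ring_scope.

(** Powers of [s] decrease when [s <= 1] and increase otherwise, so the extreme exponents suffice;
    this is the origin of the maximum of [sigma_i] and [sigma_i ^ m] in [C_i]. *)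
Lemma expr_le_max (R : realDomainType) (s : R) (m j : nat) :
  0 <= s -> (0 < j <= m)%N -> s ^+ j <= Num.max s (s ^+ m).
Proof.
move=> s0 /andP[j0 jm]; rewrite le_max; have [s1|s1] := leP s 1.
  by rewrite ler_iXnr.
by rewrite ler_weXn2l ?orbT // ltW.
Qed.

(** Scalar recursion for one component. A step contracts by [t], or else the bound restarts from
    [u v]: the [k.+1 - v <= m] steps from there cost at most [Num.max s (s ^+ m)], and
    [t ^+ v <= t ^+ (k.+1 - m)] because [t <= 1]. *)
Lemma two_regime_bound (R : realFieldType) (u : nat -> R) (s t K C : R)
    (m : nat) :
  (0 < m)%N -> 0 <= s -> 0 < t -> t <= 1 -> 0 <= K ->
  Num.max s (s ^+ m) / t ^+ m * K <= C ->
  (forall k, `|u k.+1| <= s * `|u k|) ->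
  (forall k, (k < m)%N -> `|u k| <= C * t ^+ k) ->
  (forall k, `|u k.+1| <= t * `|u k| \/
     exists2 v : nat, (k.+1 - m <= v <= k)%N & `|u v| <= K * t ^+ v) ->
  forall k, `|u k| <= C * t ^+ k.
Proof.
move=> m0 s0 t0 t1 K0 KC us u_init uK; elim=> [|k IH]; first exact: u_init.
have [km|mk] := ltnP k.+1 m; first exact: u_init.
have [u1|[v /andP[mv vk] uv]] := uK k.
  by rewrite (le_trans u1) // exprS mulrCA ler_pM2l.
have iter_us j : `|u (v + j)%N| <= s ^+ j * `|u v|.
  elim: j => [|j IHj]; first by rewrite addn0 mul1r.
  by rewrite addnS exprS -mulrA (le_trans (us _)) // ler_wpM2l.
have jm : (0 < k.+1 - v <= m)%N.
  by rewrite subn_gt0 ltnS vk /= leq_subCl.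
rewrite -[X in u X](subnKC (leqW vk)) (le_trans (iter_us _)) //.
rewrite (le_trans (ler_pM _ _ (expr_le_max s0 jm) uv)) ?exprn_ge0 //.
have tv : t ^+ v <= t ^+ (k.+1 - m).
  by rewrite ler_wiXn2l // ltW.
rewrite -[X in C * t ^+ X](subnKC mk) exprD mulrA.
have tm0 : 0 < t ^+ m by rewrite exprn_gt0.
rewrite mulrA ler_pM ?mulr_ge0 ?le_max ?s0 //.
- by rewrite exprn_ge0 // ltW.
- by rewrite -ler_pdivrMr // mulrAC.
Qed.

(** Split the sum at [i] and bound the coefficients by [p = 1 - a * lambda ord0 >= 0] before [i] and
    by [-q = 1 - a * lambda i] from [i] on. If the first alternative fails then [q > p], so
    [q * T <= p * S] gives [T <= S]. *)
Lemma nonneg_sum_alternative (R : realFieldType) (n : nat)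
    (lambda w : 'I_n.+1 -> R) (a : R) (i : 'I_n.+1) :
  {homo lambda : j k / (j <= k)%N >-> j <= k} ->
  0 <= a -> a * lambda ord0 <= 1 -> (forall j, 0 <= w j) ->
  0 <= \sum_j (1 - a * lambda j) * w j ->
  a * (lambda ord0 + lambda i) <= 2 \/ w i <= \sum_(j < n.+1 | (j < i)%N) w j.
Proof.
move=> lambda_homo a0 a1 w0 sum0.
have [le2|gt2] := leP (a * (lambda ord0 + lambda i)) 2; [by left | right].
rewrite mulrDr in gt2.
set S := \sum_(_ < _ | _) _.
pose T := \sum_(j < n.+1 | ~~ (j < i)%N) w j.
have wT : w i <= T.
  by rewrite /T (bigD1 i) ?ltnn //= lerDl sumr_ge0.
have S0 : 0 <= S by rewrite sumr_ge0.
have : 0 <= (1 - a * lambda ord0) * S + (1 - a * lambda i) * T.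
  rewrite (le_trans sum0) // (bigID (fun j : 'I_n.+1 => (j < i)%N)) /=.
  by rewrite !mulr_sumr lerD // ler_sum // => j; rewrite -?leqNgt => ij;
    rewrite ler_wpM2r // lerD2l lerN2 ler_wpM2l // lambda_homo.
nra.
Qed.

Lemma quad_form_diag (R : comNzRingType) (n : nat) (d : 'rV[R]_n)
    (u : 'cV[R]_n) :
  (u^T *m diag_mx d *m u) 0 0 = \sum_i d 0 i * u i 0 ^+ 2.
Proof.
by rewrite -mulmxA mul_diag_mx mxE; apply: eq_bigr => i _; rewrite !mxE mulrCA.
Qed.

Lemma psiA_sqr (R : realType) (n : nat) (psi : R -> R) (lambda : 'I_n.+1 -> R) :
  psiA psi lambda ^+ 2 = diag_mx (\row_i psi (lambda i) ^+ 2).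
Proof.
rewrite expr2 -mulmxE mulmx_diag; congr diag_mx.
by apply/rowP => i; rewrite !mxE expr2.
Qed.

(* The quotient N / D is junk when D = 0, but then N - a D = N >= 0. *)
Lemma stepsize_sum_ge0 (R : realType) (n : nat) (lambda : 'I_n.+1 -> R)
    (psi : R -> R) (a : R) (u : 'cV[R]_n.+1) :
  (forall i, 0 <= lambda i) ->
  a <= (u^T *m psiA psi lambda ^+ 2 *m u) 0 0 /
       (u^T *m diagA lambda *m psiA psi lambda ^+ 2 *m u) 0 0 ->
  0 <= \sum_j (1 - a * lambda j) * (psi (lambda j) * u j 0) ^+ 2.
Proof.
move=> lambda0; rewrite psiA_sqr /diagA.
rewrite -(mulmxA _ (diag_mx _) (diag_mx _)) mulmx_diag.
rewrite !quad_form_diag; set N := \sum_i _; set D := \sum_i _ => aND.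
have -> : \sum_j (1 - a * lambda j) * (psi (lambda j) * u j 0) ^+ 2 = N - a * D.
  rewrite mulr_sumr -sumrB; apply: eq_bigr => j _; rewrite !mxE; ring.
have N0 : 0 <= N by apply: sumr_ge0 => j _; rewrite mxE mulr_ge0 ?sqr_ge0.
have : 0 <= D.
  by apply: sumr_ge0 => j _; rewrite !mxE -mulrA mulr_ge0 // mulr_ge0 ?sqr_ge0.
rewrite le_eqVlt => /predU1P[<-|D0]; first by rewrite mulr0 subr0.
by rewrite subr_ge0 -ler_pdivlMr.
Qed.

Lemma gradient_step (R : realType) (n : nat) (lambda : 'I_n.+1 -> R)
    (b x : 'cV[R]_n.+1) (a : R) (i : 'I_n.+1) :
  gradient (quad lambda b) (x - a *: gradient (quad lambda b) x) i 0 =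
  (1 - a * lambda i) * gradient (quad lambda b) x i 0.
Proof. by rewrite !gradient_quad !mul_diag_mx !mxE; ring. Qed.

Theorem theorem1 (R : realType) (n : nat) (lambda : 'I_n.+1 -> R)
    (b : 'cV[R]_n.+1) (x g : nat -> 'cV[R]_n.+1) (alpha : nat -> R)
    (m : nat) (M1 : R) (psi : R -> R)
    (lambda_gt0 : 0 < lambda ord0)
    (lambda_incr : forall i j : 'I_n.+1, (i < j)%N -> lambda i < lambda j)
    (gE : forall k, g k = gradient (quad lambda b) (x k))
    (alpha_gt0 : forall k, 0 < alpha k)
    (xS : forall k, x k.+1 = x k - alpha k *: g k)
    (hB : propertyB lambda m M1 psi alpha g) :
  (exists k, g k = 0) \/
  ((fun k => enorm (g k)) @ \oo --> (0 : R) /\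
   forall (k : nat) (i : 'I_n.+1),
     `|g k i 0| <= Cconst lambda m M1 psi g i * theta lambda M1 ^+ k).
Proof.
have [|g_neq0] := pselect (exists k, g k = 0); [by left | right].
case: hB => m0 M10 lM1 [_ [d d_psi]] hB.
have gN k : g k != 0 by apply/eqP => gk; apply: g_neq0; exists k.
have lambda_homo : {homo lambda : j k / (j <= k)%N >-> j <= k}.
  move=> j k; rewrite leq_eqVlt => /predU1P[/val_inj->//|/lambda_incr].
  exact: ltW.
have lambda_pos i : 0 < lambda i.
  by rewrite (lt_le_trans lambda_gt0) // lambda_homo.
have psi_pos i : 0 < psi (lambda i).
  by have [] := d_psi (lambda i); rewrite ?lambda_homo //= ?leq_ord.
have gS k i : g k.+1 i 0 = (1 - alpha k * lambda i) * g k i 0.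
  by rewrite !gE xS gE gradient_step.
have alphaM k : 1 <= alpha k * M1.
  by have [/andP[_]] := hB k (gN k); rewrite -div1r ler_pdivrMr // mulrC.
have alphal k : alpha k * lambda ord0 <= 1.
  by have [/andP[+ _]] := hB k (gN k); rewrite -div1r ler_pdivlMr // mulrC.
have sum0 k : exists2 v : nat, (k.+1 - m <= v <= k)%N &
    0 <= \sum_j (1 - alpha k * lambda j) * (psi (lambda j) * g v j 0) ^+ 2.
  have [_ [v vk av]] := hB k (gN k); exists v => //.
  by apply: stepsize_sum_ge0 => // j; exact: ltW.
set t := theta lambda M1.
have frac k (y : R) : 0 <= y -> y / M1 <= alpha k * y.
  by move=> y0; rewrite ler_pdivrMr // mulrAC ler_peMl.
have t1 : t < 1 by rewrite ltrBlDr ltrDl divr_gt0.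
have t0 : 0 < t.
  rewrite lt_def subr_ge0 ler_pdivrMr // mul1r lM1 andbT.
  apply/negP => /eqP tE; apply: g_neq0; exists 1%N.
  have a0 : alpha 0%N * lambda ord0 = 1.
    apply/eqP; rewrite eq_le alphal /=.
    by have := frac 0%N _ (ltW lambda_gt0); move: tE; rewrite /t /theta; lra.
  (* At [k = 0] the window contains only [v = 0]. As [alpha 0 * lambda j >= 1] for all [j], every
     term of the nonnegative sum is nonpositive, hence zero. *)
  have [v] := sum0 0%N; rewrite leqn0 => /andP[_ /eqP->] sum_ge0.
  have term_ge0 j : 0 <= (alpha 0%N * lambda j - 1) *
      (psi (lambda j) * g 0%N j 0) ^+ 2.
    by rewrite mulr_ge0 ?sqr_ge0 // subr_ge0 -a0 ler_pM2l // lambda_homo.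
  have sumE : \sum_j (alpha 0%N * lambda j - 1) *
      (psi (lambda j) * g 0%N j 0) ^+ 2 = 0.
    apply/eqP; rewrite eq_le sumr_ge0 // andbT -oppr_ge0 -sumrN.
    by under eq_bigr do rewrite -mulNr opprB.
  apply/colP => j; rewrite gS mxE.
  have /(_ j isT)/eqP := psumr_eq0P (fun j _ => term_ge0 j) sumE.
  rewrite mulf_eq0 sqrf_eq0 mulf_eq0 (gt_eqF (psi_pos j)) /= subr_eq0.
  by case/orP => /eqP->; rewrite ?subrr ?mul0r ?mulr0.
pose C := Cconst lambda m M1 psi g.
have bound i k : `|g k i 0| <= C i * t ^+ k.
  (* Strong induction on the index, for all [k] at once: the bound on component [i] at time [v] uses
     those on all earlier components at time [v]. *)
  elim/ltn_ind: {i}(nat_of_ord i) {-2}i (erefl (nat_of_ord i)) k => i' IH i iE.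
  subst i'; rewrite /C CconstE; have [->|i0] := eqVneq i ord0.
    elim=> [|k IHk]; first by rewrite mulr1.
    rewrite gS normrM exprS mulrCA ler_pM // ger0_norm ?subr_ge0 //.
    by rewrite lerD2l lerN2 frac // ltW.
  set K := Num.sqrt _; set s := sigma lambda M1 i.
  have s_ge k : `|1 - alpha k * lambda i| <= s.
    have fi := frac k _ (ltW (lambda_pos i)).
    rewrite ler_norml /s /sigma le_max lerD2l lerN2 fi orbT andbT.
    rewrite lerNl opprB le_max lerD2r ler_pdivlMr // mulrAC.
    by rewrite ler_piMl // ltW.
  (* [K] bounds the [psi]-weighted component, whence the division by [psi (lambda i)]. *)
  apply: (@two_regime_bound _ (fun k => g k i 0) s t (K / psi (lambda i)) _ m).
  - exact: m0.
  - exact: le_trans (s_ge 0%N).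
  - exact: t0.
  - exact: ltW.
  - by rewrite divr_ge0 ?sqrtr_ge0 // ltW.
  - rewrite le_max; apply/orP; right.
    by rewrite invfM !mulrA (mulrAC _ K).
  - by move=> k; rewrite gS normrM ler_wpM2r.
  - move=> k km; rewrite -ler_pdivrMr ?exprn_gt0 // le_max; apply/orP; left.
    (* The entry for [k = 0] is the seed of the iterated maximum, whose range starts at 1. *)
    case: k km => [|k] km; first by rewrite divr1 bigmax_ge_id.
    have km1 : k.+1 \in index_iota 1 m by rewrite mem_index_iota.
    exact: (le_bigmax_seq _ k.+1 xpredT (fun l => `|g l i 0| / t ^+ l) km1).
  move=> k; have [v vk sumk] := sum0 k.
  have [|||ai|wi] := nonneg_sum_alternative i lambda_homo _ _ _ sumk.
  - exact: ltW.
  - exact: alphal.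
  - by move=> j; exact: sqr_ge0.
  (* Here [alpha k * lambda i - 1 <= 1 - alpha k * lambda ord0 <= t], and [1 - alpha k * lambda i <=
     1 - lambda i / M1 <= t]. *)
  - left; rewrite gS normrM ler_wpM2r // ler_norml /t /theta.
    have fi := frac k _ (ltW (lambda_pos i)).
    have f0 := frac k _ (ltW lambda_gt0).
    have : lambda ord0 / M1 <= lambda i / M1.
      by rewrite ler_pM2r ?invr_gt0 // lambda_homo.
    by move: ai; rewrite mulrDr; lra.
  right; exists v => //; rewrite mulrAC ler_pdivlMr // mulrC.
  (* Both sides become square roots, so that [wi], which compares squares, applies and [t ^+ v]
     moves into the sum. *)
  rewrite -[X in X * _ <= _](gtr0_norm (psi_pos i)) -normrM -sqrtr_sqr.
  have tv0 : 0 <= t ^+ v by rewrite exprn_ge0 // ltW.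
  rewrite -[X in _ <= _ * X](ger0_norm tv0) -sqrtr_sqr /K -sqrtrM; last first.
    by apply: sumr_ge0 => j _; rewrite -exprMn sqr_ge0.
  rewrite ler_sqrt; last first.
    rewrite mulr_ge0 ?sqr_ge0 //.
    by apply: sumr_ge0 => j _; rewrite -exprMn sqr_ge0.
  rewrite (le_trans wi) // mulr_suml ler_sum // => j ji.
  rewrite exprMn -[X in _ <= X]mulrA -[X in _ <= _ * X]exprMn.
  rewrite ler_wpM2l ?sqr_ge0 //.
  have gv := IH _ ji j erefl v.
  by rewrite -real_normK ?num_real // lerXn2r ?nnegrE // (le_trans _ gv).
split; last by move=> k i; exact: bound.
(* Summing the squared component bounds gives [enorm (g k) <= Num.sqrt S * t ^+ k], and [t < 1]. *)
set S := \sum_i C i ^+ 2.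
have S0 : 0 <= S by apply: sumr_ge0 => j _; exact: sqr_ge0.
have tcvg : (fun k => Num.sqrt S * t ^+ k) @ \oo --> (0 : R).
  have t_norm : `|t| < 1 by rewrite gtr0_norm.
  have := cvgMl_tmp (a := Num.sqrt S) (cvg_expr t_norm).
  by rewrite mulr0; exact.
apply: (squeeze_cvgr _ (cvg_cst 0) tcvg); near=> k.
have tk0 : 0 <= t ^+ k by rewrite exprn_ge0 // ltW.
rewrite sqrtr_ge0 /= -[t ^+ k](ger0_norm tk0) -sqrtr_sqr -sqrtrM // /enorm.
rewrite ler_sqrt ?mulr_ge0 ?sqr_ge0 // mulr_suml ler_sum // => j _.
rewrite -exprMn -real_normK ?num_real //.
by rewrite lerXn2r ?nnegrE // (le_trans _ (bound j k)).
Unshelve. all: by end_near.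
Qed.
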